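(* Let $S$ be a set of monic $\Omega$-polynomials in $K\langle X;\Omega\rangle$, $>$ a monomial ordering on $\mathfrak{S}(X)$, and $Id(S)$ the ideal generated by $S$. The following are equivalent: (I) $S$ is a Gröbner–Shirshov basis in $K\langle X;\Omega\rangle$. (II) For every nonzero $f\in Id(S)$, $\bar f=u|_{\bar s}$ for some $u\in\mathfrak{S}^\star(X)$ and $s\in S$. (II$'$) Every nonzero $f\in Id(S)$ can be written $f=\alpha_1u_1|_{s_1}+\cdots+\alpha_nu_n|_{s_n}$ with $\alpha_i\in K$, $s_i\in S$, $u_i\in\mathfrak{S}^\star(X)$ and $u_1|_{\overline{s_1}}>u_2|_{\overline{s_2}}>\cdots>u_n|_{\overline{s_n}}$. (III) The set $Irr(S)=\{w\in\mathfrak{S}(X)\mid w\ne u|_{\bar s}\text{ for all }u\in\mathfrak{S}^\star(X),\ s\in S\}$ is (its image is) a $K$-basis of $K\langle X;\Omega|S\rangle=K\langle X;\Omega\rangle/Id(S)$.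
   Context: General setup. $K$ is a commutative ring with unit, $X$ a set, and $\Omega=\bigcup_{n\ge1}\Omega_n$ a set of operation symbols, $\Omega_n$ being the $n$-ary ones. For a set $A$ let $\Omega(A)=\{\delta(u_1,\dots,u_t)\mid t\ge1,\ \delta\in\Omega_t,\ u_i\in A\}$ (formal expressions). For a set $Y$, $S(Y)$ denotes the free semigroup (nonempty words) and $Y^*$ the free monoid on $Y$. Put $\mathfrak{S}_0=S(X)$ and $\mathfrak{S}_n=S(X\cup\Omega(\mathfrak{S}_{n-1}))$ for $n\ge1$; then $\mathfrak{S}_0\subset\mathfrak{S}_1\subset\cdots$ and $\mathfrak{S}(X)=\bigcup_{n\ge0}\mathfrak{S}_n$ (the $\Omega$-words). $K\langle X;\Omega\rangle$ is the free $K$-module with basis $\mathfrak{S}(X)$, with associative multiplication given by concatenation and each $\delta\in\Omega_n$ extended $K$-multilinearly; it is the free associative algebra with multiple linear operators $\Omega$ on $X$; its elements are $\Omega$-polynomials. The prime $\Omega$-words are the elements of $X\cup\Omega(\mathfrak{S}(X))$; each $u\in\mathfrak{S}(X)$ is uniquely a product $u_1\cdots u_n$ of prime $\Omega$-words, and $bre(u)=n$. For a symbol $\star\notin X$, $\mathfrak{S}^\star(X)$ is the set of elements of $\mathfrak{S}(X\cup\{\star\})$ containing exactly one occurrence of $\star$; for $u\in\mathfrak{S}^\star(X)$ and an $\Omega$-polynomial $s$, $u|_s$ denotes the result of replacing $\star$ by $s$ (extended linearly in $s$). A monomial ordering is a well ordering $>$ on $\mathfrak{S}(X)$ such that $w>v$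 implies $u|_w>u|_v$ for all $u\in\mathfrak{S}^\star(X)$. For nonzero $f$, $\bar f$ is its largest $\Omega$-word; $f$ is monic if the coefficient of $\bar f$ is $1$. The ideal $Id(S)$ generated by a set $S$ is the $K$-span of all $u|_s$ with $u\in\mathfrak{S}^\star(X)$, $s\in S$, and $K\langle X;\Omega|S\rangle=K\langle X;\Omega\rangle/Id(S)$. For monic $f,g$: (I) if $w=\bar f a=b\bar g$ for some $a,b\in\mathfrak{S}(X)$ with $bre(w)<bre(\bar f)+bre(\bar g)$, then $(f,g)_w=fa-bg$ is an intersection composition; (II) if $w=\bar f=u|_{\bar g}$ for some $u\in\mathfrak{S}^\star(X)$, then $(f,g)_w=f-u|_g$ is an including composition. For a set $S$ of monic $\Omega$-polynomials, an $\Omega$-word $w$, and $\Omega$-polynomials $p,q$, we write $p\equiv q\ \mathrm{mod}(S,w)$ if $p-q=\sum_i\alpha_iu_i|_{s_i}$ with $\alpha_i\in K$, $u_i\in\mathfrak{S}^\star(X)$, $s_i\in S$ and $u_i|_{\overline{s_i}}<w$ for all $i$. $S$ is a Gröbner–Shirshov basis if every composition $(f,g)_w$ with $f,g\in S$ satisfies $(f,g)_w\equiv0\ \mathrm{mod}(S,w)$. *)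

(* Defs.v *)
From HB Require Import structures.
From mathcomp Require Import all_boot all_order all_algebra.
From Stdlib Require Import ClassicalEpsilon.
Set Implicit Arguments. Unset Strict Implicit. Unset Printing Implicit Defensive.
Import GRing.Theory.

Record signature := Signature { op :> Type; arity : op -> nat }.

(* Prime Omega-words over an alphabet A: a letter, or delta(u_1,...,u_t)
   with t = arity delta and each u_i an Omega-word.  An Omega-word is a
   NONEMPTY sequence of prime Omega-words, represented as (head, tail). *)
Inductive prim (Om : signature) (A : Type) : Type :=
  | PX of A
  | PO (o : Om) of ('I_(arity o) -> prim Om A * seq (prim Om A)).
Arguments PX {Om A}.
Arguments PO {Om A}.

Definition word (Om : signature) (A : Type) := (prim Om A * seq (prim Om A))%type.

(* classical decidable equality on prime words (X is an arbitrary set) *)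
Definition prim_eqb Om A (x y : prim Om A) : bool :=
  if excluded_middle_informative (x = y) then true else false.
Lemma prim_eqP Om A : Equality.axiom (@prim_eqb Om A).
Proof. by move=> x y; rewrite /prim_eqb; case: excluded_middle_informative => h; constructor. Qed.
HB.instance Definition _ Om A := hasDecEq.Build (prim Om A) (@prim_eqP Om A).
HB.instance Definition _ Om A := Equality.on (word Om A).

Section Words.
Variables (Om : signature) (A : Type).

Definition wcat (u v : word Om A) : word Om A := (u.1, u.2 ++ v.1 :: v.2).

Definition bre (u : word Om A) : nat := (size u.2).+1.

(* u|_w : replace the symbol star (= None) in u by the word w *)
Fixpoint substP (w : word Om A) (p : prim Om (option A)) : word Om A :=
  match p with
  | PX None => w
  | PX (Some x) => (PX x, [::])
  | PO o f => (PO o (fun i => let (q, qs) := f i in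
                 foldl (fun acc r => wcat acc (substP w r)) (substP w q) qs), [::])
  end.
Definition substW (w : word Om A) (u : word Om (option A)) : word Om A :=
  foldl (fun acc r => wcat acc (substP w r)) (substP w u.1) u.2.

Fixpoint starsP (p : prim Om (option A)) : nat :=
  match p with
  | PX None => 1
  | PX (Some _) => 0
  | PO o f => sumn [seq (let (q, qs) := f i in
                         starsP q + sumn (map starsP qs))%N | i <- enum 'I_(arity o)]
  end.
Definition starsW (u : word Om (option A)) : nat :=
  (starsP u.1 + sumn (map starsP u.2))%N.

Definition is_ctx (u : word Om (option A)) : Prop := starsW u = 1%N.

End Words.

Record monomial_order (Om : signature) (X : Type)
    (lt : word Om X -> word Om X -> Prop) : Prop := {
  mo_irrefl : forall w, ~ lt w w;
  mo_trans : forall u v w, lt u v -> lt v w -> lt u w;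
  mo_total : forall v w, v <> w -> lt v w \/ lt w v;
  mo_wellorder : forall P : word Om X -> Prop, (exists w, P w) ->
      exists m, P m /\ forall w, P w -> m <> w -> lt m w;
  mo_compat : forall (u : word Om (option X)) v w, is_ctx u -> lt v w ->
      lt (substW v u) (substW w u)
}.

Section Polys.
Local Open Scope ring_scope.
Variables (K : comPzRingType) (Om : signature) (X : Type)
          (lt : word Om X -> word Om X -> Prop).

(* Omega-polynomials are formal K-linear combinations of Omega-words,
   identified up to equality of coefficients (see peq). *)
Definition opoly := seq (K * word Om X).
Definition ctx := word Om (option X).

Definition ocoef (p : opoly) (w : word Om X) : K :=
  \sum_(t <- p) (if t.2 == w then t.1 else 0).
Definition peq (p q : opoly) : Prop := forall w, ocoef p w = ocoef q w.
Definition nonzero (p : opoly) : Prop := exists w, ocoef p w != 0.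

Definition pzero : opoly := [::].
Definition pscale (c : K) (p : opoly) : opoly := [seq (c * t.1, t.2) | t <- p].
Definition psub (p q : opoly) : opoly := p ++ pscale (-1) q.
Definition pmulr (p : opoly) (a : word Om X) : opoly := [seq (t.1, wcat t.2 a) | t <- p].
Definition pmull (b : word Om X) (p : opoly) : opoly := [seq (t.1, wcat b t.2) | t <- p].
Definition psubst (u : ctx) (p : opoly) : opoly := [seq (t.1, substW t.2 u) | t <- p].
Definition comb (l : seq (K * ctx * opoly)) : opoly :=
  flatten [seq pscale t.1.1 (psubst t.1.2 t.2) | t <- l].

Definition is_lead (p : opoly) (w : word Om X) : Prop :=
  ocoef p w != 0 /\ forall v, ocoef p v != 0 -> v = w \/ lt v w.
Definition omonic (p : opoly) : Prop := exists w, is_lead p w /\ ocoef p w = 1.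

Variable S : opoly -> Prop.

Definition in_Id (f : opoly) : Prop :=
  exists l : seq (K * ctx * opoly),
    (forall t, t \in l -> is_ctx t.1.2 /\ S t.2) /\ peq f (comb l).

Definition congr_mod (w : word Om X) (p q : opoly) : Prop :=
  exists l : seq (K * ctx * opoly),
    (forall t, t \in l -> [/\ is_ctx t.1.2, S t.2 &
        exists ws, is_lead t.2 ws /\ lt (substW ws t.1.2) w])
    /\ peq (psub p q) (comb l).

Definition GSbasis : Prop :=
  forall f g, S f -> S g ->
  (forall wf wg a b, is_lead f wf -> is_lead g wg ->
     wcat wf a = wcat b wg -> (bre (wcat wf a) < bre wf + bre wg)%N ->
     congr_mod (wcat wf a) (psub (pmulr f a) (pmull b g)) pzero)
  /\
  (forall wf wg (u : ctx), is_lead f wf -> is_lead g wg -> is_ctx u ->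
     wf = substW wg u ->
     congr_mod wf (psub f (psubst u g)) pzero).

Definition condII : Prop :=
  forall f, in_Id f -> nonzero f ->
  exists wf (u : ctx) s ws,
    [/\ is_lead f wf, is_ctx u, S s, is_lead s ws & wf = substW ws u].

Fixpoint decr (l : seq (word Om X)) : Prop :=
  match l with
  | a :: ((b :: _) as l') => lt b a /\ decr l'
  | _ => True
  end.

(* entries (alpha_i, u_i, s_i, \bar s_i) *)
Definition condII' : Prop :=
  forall f, in_Id f -> nonzero f ->
  exists l : seq (K * ctx * opoly * word Om X),
    [/\ forall t, t \in l -> [/\ is_ctx t.1.1.2, S t.1.2 & is_lead t.1.2 t.2],
        peq f (comb [seq t.1 | t <- l])
      & decr [seq substW t.2 t.1.1.2 | t <- l]].

Definition Irr (w : word Om X) : Prop :=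
  forall (u : ctx) s ws, is_ctx u -> S s -> is_lead s ws -> w <> substW ws u.

Definition Irr_basis : Prop :=
  (forall f : opoly, exists g : opoly,
      (forall t, t \in g -> Irr t.2) /\ in_Id (psub f g))
  /\
  (forall g : opoly, uniq [seq t.2 | t <- g] -> (forall t, t \in g -> Irr t.2) ->
      in_Id g -> forall t, t \in g -> t.1 = 0).

End Polys.

(* Main.v *)
Require Import Defs.
From HB Require Import structures.
From mathcomp Require Import all_boot all_order all_algebra.
From mathcomp Require Import ring zify.
From Stdlib Require Import Classical FunctionalExtensionality Eqdep.
Set Implicit Arguments. Unset Strict Implicit. Unset Printing Implicit Defensive.

(** A composition-diamond lemma.  If a word [w] contains the leading words of
    [s1] and [s2] (both in [S]) at two places, the two occurrences are disjoint,
    nested or overlapping; in the first case the difference of the two multiples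
    is trivially a combination of multiples with leading words below [w], in the
    others the Groebner-Shirshov hypothesis gives it.  Hence in a combination of
    multiples of [S] all terms with maximal leading word can be merged into one,
    and well-founded induction shows that either this word leads the sum or
    the maximum can be lowered.  Conversely, dividing a composition below [w] by
    [S] leaves an irreducible remainder in the ideal, which vanishes when the
    irreducible words are independent. *)

(** * Comparing two factorizations of one sequence *)

Lemma cat_eq_catP (T : Type) (l l' a b : seq T) :
  l ++ a = l' ++ b -> size l <= size l' ->
  exists2 m, l' = l ++ m & a = m ++ b.
Proof.
elim: l l' => [|x l IH] [|y l'] //=; first by exists [::].
- by move=> -> _; exists (y :: l').
- by case=> -> /IH H /H[m -> ->]; exists m.
Qed.

(** A single entry cannot straddle a border, so [p] lies in [l], [x] or [r]. This locates an
    operator prime relative to a block of primes. *)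
Lemma cat3_eq_catP (T : Type) (l x r l' r' : seq T) (p : T) :
  l ++ x ++ r = l' ++ p :: r' ->
  [\/ exists2 m, l = l' ++ p :: m & r' = m ++ x ++ r,
      exists m n, [/\ x = m ++ p :: n, l' = l ++ m & r' = n ++ r]
    | exists2 m, r = m ++ p :: r' & l' = l ++ x ++ m].
Proof.
move=> E; case: (leqP (size l) (size l')) => hl.
  have [m -> {}E] := cat_eq_catP E hl.
  case: (leqP (size x) (size m)) => hx.
    have [k -> {}E] := cat_eq_catP E hx.
    by apply: Or33; exists k.
  have [k xE] := cat_eq_catP (esym E) (ltnW hx).
  case: k xE => [|q n] xE.
    by rewrite xE cats0 ltnn in hx.
  case=> -> ->; apply: Or32; exists m, n; split=> //.
have [k lE] := cat_eq_catP (esym E) (ltnW hl).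
case: k lE => [|q n] lE.
  by rewrite lE cats0 ltnn in hl.
by case=> -> ->; apply: Or31; exists n.
Qed.

(** * Structural induction on prime words *)

Section PrimInd.
Variables (Om : signature) (A : Type) (P : prim Om A -> Prop).
Hypothesis HX : forall a, P (PX a).
Hypothesis HO : forall (o : Om) f,
  (forall i, List.Forall P ((f i).1 :: (f i).2)) -> P (PO o f).

(** The arguments of an operator are nested inside pairs and sequences; the inner [fix] carries the
    induction hypothesis to every prime factor of every argument. *)
Fixpoint prim_nested_ind (p : prim Om A) : P p :=
  match p with
  | PX a => HX a
  | PO o f => HO (fun i =>
      let: (q, qs) as u := f i return List.Forall P (u.1 :: u.2) in
      List.Forall_cons q (prim_nested_ind q)
        ((fix prims_ind s : List.Forall P s :=
            match s with
            | [::] => List.Forall_nil P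
            | r :: s' => List.Forall_cons r (prim_nested_ind r) (prims_ind s')
            end) qs))
  end.
End PrimInd.

(** * Contexts as functions on words, and relative positions of two occurrences *)

Section WordSeq.
Variables (Om : signature) (A : Type).
Implicit Types (u v w x y : word Om A) (l r : seq (prim Om A)).

Definition wseq w : seq (prim Om A) := w.1 :: w.2.

Lemma wseq_inj : injective wseq.
Proof. by move=> [p l] [q r] [-> ->]. Qed.

Lemma wseq_exists l : l <> [::] -> exists w, l = wseq w.
Proof. by case: l => // p l _; exists (p, l). Qed.

Lemma wseq_cat u v : wseq (wcat u v) = wseq u ++ wseq v.
Proof. by []. Qed.

Lemma size_wseq u : size (wseq u) = bre u.
Proof. by []. Qed.

(** [wcat] does not suffice here: words are nonempty, while the flanks [l] and [r] of an occurrence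
    may be empty. *)
Definition wmid l w r : word Om A :=
  if l is p :: l' then (p, l' ++ wseq w ++ r) else (w.1, w.2 ++ r).

Lemma wseq_mid l w r : wseq (wmid l w r) = l ++ wseq w ++ r.
Proof. by case: l. Qed.

Lemma wmid_mid l r l' r' w :
  wmid l (wmid l' w r') r = wmid (l ++ l') w (r' ++ r).
Proof. by apply: wseq_inj; rewrite !wseq_mid !catA. Qed.

Lemma wmid0 w : wmid [::] w [::] = w.
Proof. by apply: wseq_inj; rewrite wseq_mid cats0. Qed.

Definition upd n (f : 'I_n -> word Om A) (i : 'I_n) w : 'I_n -> word Om A :=
  fun j => if j == i then w else f j.

Definition opw (o : Om) (f : 'I_(arity o) -> word Om A) : word Om A :=
  (PO o f, [::]).

(* One-hole contexts, given by their substitution functions [w |-> u|_w]. *)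
Inductive wctx : (word Om A -> word Om A) -> Prop :=
  | Wctx_hole l r : wctx (fun w => wmid l w r)
  | Wctx_op l r (o : Om) i f F :
      wctx F -> wctx (fun w => wmid l (@opw o (upd f i (F w))) r).

Lemma wctx_ext F G : wctx F -> F =1 G -> wctx G.
Proof. by move=> hF /functional_extensionality <-. Qed.

Lemma wctx_id : wctx id.
Proof. by apply: wctx_ext (Wctx_hole [::] [::]) _ => w; rewrite wmid0. Qed.

Lemma wctx_mid l r F : wctx F -> wctx (fun w => wmid l (F w) r).
Proof.
case=> [l' r'|l' r' o i f G hG].
  by apply: wctx_ext (Wctx_hole (l ++ l') (r' ++ r)) _ => w; rewrite wmid_mid.
apply: wctx_ext (Wctx_op (l ++ l') (r' ++ r) i f hG) _ => w.
by rewrite wmid_mid.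
Qed.

Lemma wctx_comp F G : wctx F -> wctx G -> wctx (F \o G).
Proof.
move=> hF hG; elim: hF => [l r|l r o i f {}F _ IH]; first exact: wctx_mid.
exact: Wctx_op IH.
Qed.

Lemma wctx_opw (o : Om) i f F : wctx F -> wctx (fun w => @opw o (upd f i (F w))).
Proof.
move=> hF; apply: wctx_ext (Wctx_op [::] [::] i f hF) _ => w.
by rewrite wmid0.
Qed.

Lemma wctx_wcatl a : wctx (wcat a).
Proof.
apply: wctx_ext (Wctx_hole (wseq a) [::]) _ => w.
by apply: wseq_inj; rewrite wseq_mid cats0.
Qed.

Lemma wctx_wcatr a : wctx (fun w => wcat w a).
Proof. by apply: wctx_ext (Wctx_hole [::] (wseq a)) _. Qed.

(* The relative positions of an occurrence of [x] (with context [F]) and an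
   occurrence of [y] (with context [G]) in one word, up to exchanging them. *)
Inductive overlap x y :
    (word Om A -> word Om A) -> (word Om A -> word Om A) -> Prop :=
  | Overlap_disjoint (H : word Om A -> word Om A -> word Om A) :
      (forall z, wctx (H z)) -> (forall z, wctx (H^~ z)) ->
      overlap x y (H^~ y) (H x)
  | Overlap_include C D : wctx C -> wctx D -> x = D y -> overlap x y C (C \o D)
  | Overlap_intersect C a b : wctx C -> wcat x a = wcat b y ->
      bre (wcat x a) < bre x + bre y ->
      overlap x y (fun z => C (wcat z a)) (fun z => C (wcat b z)).

Lemma overlap_comp C x y F G :
  wctx C -> overlap x y F G -> overlap x y (C \o F) (C \o G).
Proof.
move=> hC [H h1 h2|B D hB hD xE|B a b hB e h].
- by apply: (@Overlap_disjoint x y (fun s t => C (H s t))) => z;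
    apply: (wctx_comp hC).
- by apply: (@Overlap_include x y (C \o B) D) => //; apply: wctx_comp.
- by apply: (@Overlap_intersect x y (C \o B)) => //; apply: wctx_comp.
Qed.

(** Occurrences inside separate factors of a product are disjoint: one function [H] of two variables
    gives both contexts, each by freezing the other variable. *)
Lemma overlap_side x y B D l m r : wctx B -> wctx D ->
  overlap x y (fun z => wmid l (B z) (m ++ wseq (D y) ++ r))
              (fun z => wmid (l ++ wseq (B x) ++ m) (D z) r).
Proof.
move=> hB hD; pose H s t := wmid l (B s) (m ++ wseq (D t) ++ r).
have HE s : H s = fun z => wmid (l ++ wseq (B s) ++ m) (D z) r.
  apply: functional_extensionality => z; apply: wseq_inj.
  by rewrite !wseq_mid !catA.
rewrite -HE; apply: (@Overlap_disjoint x y H) => z; last exact: wctx_mid.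
by rewrite HE; apply: wctx_mid.
Qed.

(** Both occurrences are blocks of consecutive primes, so comparing their end points decides the
    case, with [x] starting no later than [y]. *)
Lemma overlap_holes l r l' r' x y :
  l ++ wseq x ++ r = l' ++ wseq y ++ r' -> size l <= size l' ->
  overlap x y (fun z => wmid l z r) (fun z => wmid l' z r') \/
  overlap y x (fun z => wmid l' z r') (fun z => wmid l z r).
Proof.
move=> E hl; have [m -> {}E] := cat_eq_catP E hl.
case: (leqP (size (wseq x)) (size m)) => hx.
  have [k -> ->] := cat_eq_catP E hx; left.
  exact: (overlap_side x y l k r' wctx_id wctx_id).
have [k xE E'] := cat_eq_catP (esym E) (ltnW hx).
have kn : k <> [::] by move=> k0; rewrite xE k0 cats0 ltnn in hx.
case: (leqP (size (wseq y)) (size k)) => hy.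
  have [n kE ->] := cat_eq_catP E' hy; left.
  have ->: (fun z => wmid (l ++ m) z (n ++ r)) =
      (fun z => wmid l z r) \o (fun z => wmid m z n).
    by apply: functional_extensionality => z /=; rewrite wmid_mid.
  apply: Overlap_include; [exact: Wctx_hole|exact: Wctx_hole|].
  by apply: wseq_inj; rewrite wseq_mid xE kE.
have [n yE rE] := cat_eq_catP (esym E') (ltnW hy).
have nn : n <> [::] by move=> n0; rewrite yE n0 cats0 ltnn in hy.
have [n' nE'] := wseq_exists nn.
(* Here [y] ends after [x]. If both start together, [x] is a proper prefix of [y], and the roles of
   the two are exchanged. *)
have [m0|mn] := eqVneq m [::].
  right; rewrite m0 cats0 /=.
  have ->: (fun z => wmid l z r) = (fun z => wmid l z r') \o (fun z => wmid [::] z n).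
    by apply: functional_extensionality => z; rewrite /comp wmid_mid cats0 rE.
  apply: Overlap_include; [exact: Wctx_hole|exact: Wctx_hole|].
  by apply: wseq_inj; rewrite wseq_mid xE yE m0.
left; have [m' mE'] := wseq_exists (elimN eqP mn).
have ->: (fun z => wmid l z r) = (fun z => (fun z => wmid l z r') (wcat z n')).
  apply: functional_extensionality => z /=; apply: wseq_inj.
  by rewrite !wseq_mid rE nE' wseq_cat !catA.
have ->: (fun z => wmid (l ++ m) z r') = (fun z => (fun z => wmid l z r') (wcat m' z)).
  apply: functional_extensionality => z /=; apply: wseq_inj.
  by rewrite !wseq_mid mE' wseq_cat !catA.
apply: (@Overlap_intersect x y (fun z => wmid l z r')); first exact: Wctx_hole.
  by apply: wseq_inj; rewrite !wseq_cat -nE' -mE' xE yE -catA.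
(* The inequality is strict because the shared block [k] is nonempty. *)
rewrite -!size_wseq wseq_cat size_cat ltn_add2l -nE' yE size_cat.
by case: (k) kn => //= *; rewrite addSn ltnS leq_addl.
Qed.

(** Induction on the context [F]. A hole below an operator stays within one prime, so a proper
    intersection arises only between holes in the same product; holes below the same argument of the
    same operator are handled by the induction hypothesis. *)
Lemma overlap_total F G x y : wctx F -> wctx G -> F x = G y ->
  overlap x y F G \/ overlap y x G F.
Proof.
move=> hF; elim: hF G => [l r|l r o i f {}F hF IH] G hG.
  case: hG => [l' r'|l' r' o i f {}G hG] E.
    move: (congr1 wseq E); rewrite !wseq_mid => {}E.
    case: (leqP (size l) (size l')) => h; first exact: overlap_holes.
    by apply/or_comm; apply: overlap_holes => //; apply: ltnW.
  move: (congr1 wseq E); rewrite !wseq_mid => {}E; case: (cat3_eq_catP E) => {E}.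
  - case=> m -> ->; right.
    exact: (overlap_side y x l' m r (wctx_opw i f hG) wctx_id).
  - case=> m [n [xE -> ->]]; left.
    have ->: (fun w => wmid (l ++ m) (opw (upd f i (G w))) (n ++ r)) =
       (fun z => wmid l z r) \o (fun w => wmid m (opw (upd f i (G w))) n).
      by apply: functional_extensionality => z /=; rewrite wmid_mid.
    apply: Overlap_include; [exact: Wctx_hole|exact: Wctx_op|].
    by apply: wseq_inj; rewrite wseq_mid xE.
  - case=> m -> ->; left.
    exact: (overlap_side x y l m r' wctx_id (wctx_opw i f hG)).
case: hG => [l' r'|l' r' o' i' f' {}G hG] E.
  move: (congr1 wseq E); rewrite !wseq_mid => {}E; case: (cat3_eq_catP (esym E)) => {E}.
  - case=> m -> ->; left.
    exact: (overlap_side x y l m r' (wctx_opw i f hF) wctx_id).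
  - case=> m [n [yE -> ->]]; right.
    have ->: (fun w => wmid (l' ++ m) (opw (upd f i (F w))) (n ++ r')) =
       (fun z => wmid l' z r') \o (fun w => wmid m (opw (upd f i (F w))) n).
      by apply: functional_extensionality => z /=; rewrite wmid_mid.
    apply: Overlap_include; [exact: Wctx_hole|exact: Wctx_op|].
    by apply: wseq_inj; rewrite wseq_mid yE.
  - case=> m -> ->; right.
    exact: (overlap_side y x l' m r wctx_id (wctx_opw i f hF)).
move: (congr1 wseq E); rewrite !wseq_mid => {}E; case: (cat3_eq_catP E) => {E}.
- case=> m -> ->; right.
  exact: (overlap_side y x l' m r (wctx_opw i' f' hG) (wctx_opw i f hF)).
- case=> m [n [xE -> ->]].
  have [m0 n0] : m = [::] /\ n = [::].
    by case: m xE => [|? []] //=; case: n.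
  move: xE; rewrite {}m0 {}n0 cats0 /= => -[oE]; subst o' => e.
  (* The type of the arguments depends on the operator, so injectivity of [PO] yields an equality of
     dependent pairs, projected here. *)
  have fE := inj_pair2 _ _ _ _ _ e.
  have {}fE j : upd f i (F x) j = upd f' i' (G y) j by rewrite fE.
  have [iE|ni] := eqVneq i' i.
    subst i'; have := fE i; rewrite /upd eqxx => FG.
    have ->: (fun w => wmid l (opw (upd f' i (G w))) r) =
        (fun z => wmid l (opw (upd f i z)) r) \o G.
      apply: functional_extensionality => z /=; congr (wmid l (opw _) r).
      apply: functional_extensionality => j; move: (fE j); rewrite /upd.
      by case: eqP.
    have hC : wctx (fun z => wmid l (opw (upd f i z)) r).
      exact: (Wctx_op l r i f wctx_id).
    by case: (IH G hG FG) => h; [left|right]; apply: (overlap_comp hC h).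
  (* The holes lie in different arguments of one operator; the two updates commute, so both can vary
     independently. *)
  left; pose H s t := wmid l (opw (upd (upd f i' (G t)) i (F s))) r.
  have HC s t : H s t = wmid l (opw (upd (upd f i (F s)) i' (G t))) r.
    congr (wmid l (opw _) r); apply: functional_extensionality => j.
    by rewrite /upd; case: eqP => // ->; rewrite eq_sym (negbTE ni).
  have ->: (fun w => wmid l (opw (upd f i (F w))) r) = (fun s => H s y).
    apply: functional_extensionality => s; congr (wmid l (opw _) r).
    apply: functional_extensionality => j; move: (fE j); rewrite /upd.
    by case: eqP => // _; case: eqP.
  have ->: (fun w => wmid l (opw (upd f' i' (G w))) r) = H x.
    apply: functional_extensionality => t; rewrite HC.
    congr (wmid l (opw _) r).
    apply: functional_extensionality => j; move: (fE j); rewrite /upd.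
    by case: (j =P i') => // _; case: eqP.
  apply: Overlap_disjoint => z; last exact: Wctx_op.
  apply: wctx_ext (Wctx_op l r i' (upd f i (F z)) hG) _ => t.
  by rewrite HC.
- case=> m -> ->; left.
  exact: (overlap_side x y l m r' (wctx_opw i f hF) (wctx_opw i' f' hG)).
Qed.
End WordSeq.

(** * Words with one star correspond to functional contexts *)

Section Contexts.
Variables (Om : signature) (A : Type).
Implicit Types (w : word Om A) (u : word Om (option A)).

Lemma substPO w (o : Om) f :
  substP w (PO o f) = opw (fun i => substW w (f i)).
Proof.
by congr (PO o _, [::]); apply: functional_extensionality => i; case: (f i).
Qed.

Lemma starsPO (o : Om) (f : 'I_(arity o) -> word Om (option A)) :
  starsP (PO o f) = \sum_i starsW (f i).
Proof.
rewrite /= sumnE big_map big_enum; apply: eq_bigr => i _.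
by rewrite /starsW; case: (f i).
Qed.

Lemma sumn_stars_opw (o : Om) (f : 'I_(arity o) -> word Om (option A)) :
  sumn [seq starsP p | p <- wseq (opw f)] = \sum_i starsW (f i).
Proof. by rewrite -starsPO /= addn0. Qed.

Lemma flatten_subst_opw w (o : Om) (f : 'I_(arity o) -> word Om (option A)) :
  flatten [seq wseq (substP w p) | p <- wseq (opw f)] =
  wseq (opw (fun i => substW w (f i))).
Proof. by rewrite -substPO; apply: cats0. Qed.

Lemma wseq_substW w u :
  wseq (substW w u) = flatten [seq wseq (substP w p) | p <- wseq u].
Proof.
case: u => p s; rewrite /substW /=; elim/last_ind: s => [|s q IH] /=.
  by rewrite cats0.
rewrite foldl_rcons wseq_cat IH map_rcons -cats1 flatten_cat /= cats0.
by rewrite catA.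
Qed.

Lemma starsWE u : starsW u = sumn [seq starsP p | p <- wseq u].
Proof. by []. Qed.

Lemma sumn_stars_cat (l r : seq (prim Om (option A))) :
  sumn [seq starsP p | p <- l ++ r] =
  sumn [seq starsP p | p <- l] + sumn [seq starsP p | p <- r].
Proof. by rewrite map_cat sumn_cat. Qed.

Fixpoint embP (p : prim Om A) : prim Om (option A) :=
  match p with
  | PX a => PX (Some a)
  | PO o f => PO o (fun i => let (q, qs) := f i in (embP q, map embP qs))
  end.
Definition embW w : word Om (option A) := (embP w.1, map embP w.2).

Lemma embPO (o : Om) f : embP (PO o f) = PO o (fun i => embW (f i)).
Proof.
by congr (PO o _); apply: functional_extensionality => i; case: (f i).
Qed.

Lemma wseq_emb w : wseq (embW w) = map embP (wseq w).
Proof. by []. Qed.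

Lemma embP_spec (p : prim Om A) :
  (forall w, substP w (embP p) = (p, [::])) /\ starsP (embP p) = 0.
Proof.
elim/prim_nested_ind: p => [a|o f IH]; first by split.
rewrite embPO; split=> [w|].
  rewrite substPO; congr (PO o _, [::]); apply: functional_extensionality => i.
  apply: wseq_inj; rewrite wseq_substW wseq_emb.
  rewrite -[in RHS](cats0 (wseq _)).
  by elim: (IH i : List.Forall _ (wseq (f i))) => //= q s [e _] _ ->; rewrite e.
rewrite starsPO big1 // => i _; rewrite starsWE wseq_emb.
by elim: (IH i : List.Forall _ (wseq (f i))) => //= q s [_ e] _ ->; rewrite e.
Qed.

Lemma flatten_subst_emb w (l : seq (prim Om A)) :
  flatten [seq wseq (substP w p) | p <- map embP l] = l.
Proof. by elim: l => //= p l ->; rewrite (embP_spec p).1. Qed.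

Lemma stars_emb (l : seq (prim Om A)) :
  sumn [seq starsP p | p <- map embP l] = 0.
Proof. by elim: l => //= p l ->; rewrite (embP_spec p).2. Qed.

(** The fixed parts of [F] are embedded without stars, and the star takes the place of the hole. *)
Lemma wctx_is_ctx F : wctx F ->
  exists2 u : word Om (option A), is_ctx u & forall w, F w = substW w u.
Proof.
elim=> [l r|l r o i f {}F _ [u hu FE]].
  exists (wmid (map embP l) (PX None, [::]) (map embP r)) => [|w].
    by rewrite /is_ctx starsWE wseq_mid !sumn_stars_cat !stars_emb.
  apply: wseq_inj; rewrite wseq_substW !wseq_mid !map_cat !flatten_cat.
  by rewrite !flatten_subst_emb /= cats0.
exists (wmid (map embP l) (opw (upd (fun j => embW (f j)) i u)) (map embP r)) => [|w].
  rewrite /is_ctx starsWE wseq_mid !sumn_stars_cat !stars_emb.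
  rewrite sumn_stars_opw (bigD1 i) //= /upd eqxx hu big1 // => j /negbTE ->.
  by rewrite starsWE wseq_emb stars_emb.
apply: wseq_inj; rewrite wseq_substW !wseq_mid !map_cat !flatten_cat.
rewrite !flatten_subst_emb flatten_subst_opw.
congr (_ ++ wseq (opw _) ++ _); apply: functional_extensionality => j; rewrite /upd.
case: eqP => _; first exact: FE.
by apply: wseq_inj; rewrite wseq_substW wseq_emb flatten_subst_emb.
Qed.

Section Inhabited.
Variable w0 : word Om A.

(** Star-free parts are turned back into words over [A] by substituting the fixed word [w0]; the
    result does not depend on this choice. *)
Let constP (p : prim Om (option A)) := starsP p = 0 ->
  forall w, substP w p = substP w0 p.
Let ctxP (p : prim Om (option A)) := starsP p = 1 ->
  wctx (fun w : word Om A => substP w p).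

Let const_seq s : List.Forall (fun p => constP p /\ ctxP p) s ->
  sumn [seq starsP p | p <- s] = 0 -> forall w,
  flatten [seq wseq (substP w p) | p <- s] =
  flatten [seq wseq (substP w0 p) | p <- s].
Proof.
elim=> //= p {}s [hp _] _ IH.
move/eqP; rewrite addn_eq0 => /andP[/eqP/hp hq /eqP/IH hl] w.
by rewrite hq hl.
Qed.

Let const_word u : List.Forall (fun p => constP p /\ ctxP p) (wseq u) ->
  starsW u = 0 -> forall w, substW w u = substW w0 u.
Proof.
move=> hu h w; apply: wseq_inj; rewrite !wseq_substW; exact: const_seq.
Qed.

Let ctx_seq s : List.Forall (fun p => constP p /\ ctxP p) s ->
  sumn [seq starsP p | p <- s] = 1 ->
  exists2 F, wctx F &
  forall w : word Om A, flatten [seq wseq (substP w p) | p <- s] = wseq (F w).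
Proof.
elim=> //= p {}s [hc hp] hs IH h.
have [[h0 h1]|[h1 h0]]: (starsP p = 0 /\ sumn [seq starsP p | p <- s] = 1) \/
  (starsP p = 1 /\ sumn [seq starsP p | p <- s] = 0) by lia.
  have [F hF FE] := IH h1.
  exists (fun w => wmid (wseq (substP w0 p)) (F w) [::]); first exact: wctx_mid.
  by move=> w; rewrite wseq_mid cats0 hc // FE.
exists (fun w => wmid [::] (substP w p)
                   (flatten [seq wseq (substP w0 p) | p <- s])).
  exact/wctx_mid/hp.
by move=> w; rewrite wseq_mid (const_seq hs h0).
Qed.

Let ctx_word u : List.Forall (fun p => constP p /\ ctxP p) (wseq u) ->
  starsW u = 1 -> wctx (fun w : word Om A => substW w u).
Proof.
move=> hu /(ctx_seq hu)[F hF FE]; apply: (wctx_ext hF) => w.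
by apply: wseq_inj; rewrite -FE wseq_substW.
Qed.

Let prim_cases (p : prim Om (option A)) : constP p /\ ctxP p.
Proof.
elim/prim_nested_ind: p => [[a|]|o f IH]; first by split.
  by split=> // _; exact: wctx_id.
split; rewrite /constP /ctxP starsPO => h.
  move=> w; rewrite !substPO; congr (opw _).
  apply: functional_extensionality => i; apply: const_word (IH i) _ w.
  by move/eqP: h; rewrite sum_nat_eq0 => /forallP/(_ i)/eqP.
(* The single star lies in exactly one argument [i]; all the others are star-free, hence
   constant. *)
have [i hi] : exists i, starsW (f i) != 0.
  apply/existsP; move/eqP: h; apply: contraTT; rewrite negb_exists => /forallP h.
  by rewrite big1 // => i _; apply/eqP/negPn/h.
have {hi h}[h1 h] : starsW (f i) = 1 /\ \sum_(j | j != i) starsW (f j) = 0.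
  move: h; rewrite (bigD1 i) //=; move: (\sum_(j | _) _) => n h.
  by split; lia.
apply: wctx_ext (wctx_opw i (fun j => substW w0 (f j)) (ctx_word (IH i) h1)) _ => w.
rewrite substPO; congr (opw _).
apply: functional_extensionality => j; rewrite /upd; case: eqVneq => [->//|nj].
apply/esym/(const_word (IH j)); move/eqP: h; rewrite sum_nat_eq0 => /forallP/(_ j).
by rewrite nj => /eqP.
Qed.

Lemma is_ctx_wctx_inhabited u : is_ctx u -> wctx (fun w : word Om A => substW w u).
Proof.
by apply: ctx_word; elim: (wseq u) => // p s IH; constructor => //; apply: prim_cases.
Qed.
End Inhabited.

Lemma is_ctx_wctx u : is_ctx u -> wctx (fun w : word Om A => substW w u).
Proof.
have [[w0]|h] := classic (inhabited (word Om A)).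
  exact: is_ctx_wctx_inhabited.
(* If there are no words at all, every function on words equals the identity. *)
by move=> _; apply: (wctx_ext (@wctx_id Om A)) => w; case: h.
Qed.
End Contexts.

(** * Coefficients, linear extensions and linear spans of polynomials *)

Section Poly.
Import GRing.Theory.
Local Open Scope ring_scope.
Variables (K : comPzRingType) (Om : signature) (X : Type).
Local Notation word := (word Om X).
Local Notation opoly := (opoly K Om X).
Implicit Types (p q f g : opoly) (v w x y : word) (F G : word -> word).

Lemma ocoef_nil w : ocoef ([::] : opoly) w = 0.
Proof. exact: big_nil. Qed.

Lemma ocoef_cons t p w :
  ocoef (t :: p) w = (if t.2 == w then t.1 else 0) + ocoef p w.
Proof. exact: big_cons. Qed.

Lemma ocoef_cat p q w : ocoef (p ++ q) w = ocoef p w + ocoef q w.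
Proof. exact: big_cat. Qed.

Lemma ocoef_scale c p w : ocoef (pscale c p) w = c * ocoef p w.
Proof.
rewrite /ocoef big_map mulr_sumr; apply: eq_bigr => t _ /=.
by case: eqP; rewrite ?mulr0.
Qed.

Lemma ocoef_sub p q w : ocoef (psub p q) w = ocoef p w - ocoef q w.
Proof. by rewrite ocoef_cat ocoef_scale mulN1r. Qed.

Definition ocoefE := (ocoef_nil, ocoef_sub, ocoef_cat, ocoef_scale, ocoef_cons).

Lemma ocoef_notin p w : w \notin [seq t.2 | t <- p] -> ocoef p w = 0.
Proof.
move=> h; rewrite /ocoef big1_seq // => t /= tp; case: eqP => // E.
by case/negP: h; rewrite -E map_f.
Qed.

Lemma ocoef_uniq p t : uniq [seq t.2 | t <- p] -> t \in p -> ocoef p t.2 = t.1.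
Proof.
elim: p => // s p IH /= /andP[hs up]; rewrite inE ocoef_cons => /orP[/eqP ->|tp].
  by rewrite eqxx ocoef_notin // addr0.
rewrite IH //; case: eqP => [E|]; last by rewrite add0r.
by case/negP: hs; rewrite E map_f.
Qed.

(** Collects like terms: a list may repeat a word, whereas independence in [Irr_basis] concerns
    lists without repetition. *)
Definition pnorm p : opoly := [seq (ocoef p w, w) | w <- undup [seq t.2 | t <- p]].

Lemma pnorm_words p : [seq t.2 | t <- pnorm p] = undup [seq t.2 | t <- p].
Proof. by rewrite -map_comp map_id. Qed.

Lemma pnorm_peq p : peq (pnorm p) p.
Proof.
move=> w; have [wp|wp] := boolP (w \in [seq t.2 | t <- p]); last first.
  by rewrite !ocoef_notin // pnorm_words mem_undup.
rewrite (@ocoef_uniq _ (ocoef p w, w)) // ?pnorm_words ?undup_uniq //.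
by apply/mapP; exists w; rewrite ?mem_undup.
Qed.

Definition peval (phi : word -> K) p : K := \sum_(t <- p) t.1 * phi t.2.

Lemma peval_ocoef phi p r : uniq r -> {subset [seq t.2 | t <- p] <= r} ->
  peval phi p = \sum_(w <- r) ocoef p w * phi w.
Proof.
move=> ur sr; under eq_bigr do rewrite mulr_suml.
rewrite exchange_big /= /peval big_seq [RHS]big_seq; apply: eq_bigr => t tp.
rewrite (bigD1_seq t.2) //=; last exact/sr/map_f.
rewrite eqxx big1 ?addr0 // => w /negbTE wt.
by rewrite eq_sym wt mul0r.
Qed.

(** Summed over a common repetition-free list of words, the value of the linear extension of [phi]
    depends on coefficients only. *)
Lemma peq_peval phi p q : peq p q -> peval phi p = peval phi q.
Proof.
move=> pq; pose r := undup ([seq t.2 | t <- p] ++ [seq t.2 | t <- q]).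
rewrite !(@peval_ocoef _ _ r) ?undup_uniq //.
- by apply: eq_bigr => w _; rewrite pq.
- by move=> w wq; rewrite mem_undup mem_cat wq orbT.
- by move=> w wp; rewrite mem_undup mem_cat wp.
Qed.

(** The linear extension of [F]; [psubst], [pmulr] and [pmull] are instances, so multiplication and
    substitution are treated alike. *)
Definition pimage F p : opoly := [seq (t.1, F t.2) | t <- p].

Lemma ocoef_pimage F p w :
  ocoef (pimage F p) w = peval (fun v => (F v == w)%:R) p.
Proof.
rewrite /ocoef big_map; apply: eq_bigr => t _ /=.
by case: eqP; rewrite (mulr1, mulr0).
Qed.

Lemma peq_pimage F p q : peq p q -> peq (pimage F p) (pimage F q).
Proof. by move=> pq w; rewrite !ocoef_pimage; apply: peq_peval. Qed.

Lemma ocoef_pimage_inj F p w :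
  injective F -> ocoef (pimage F p) (F w) = ocoef p w.
Proof.
move=> injF; rewrite /ocoef big_map; apply: eq_bigr => t _ /=.
by rewrite (inj_eq injF).
Qed.

Lemma ocoef_pimage_neq0 F p w : injective F -> ocoef (pimage F p) w != 0 ->
  exists2 v, w = F v & ocoef p v != 0.
Proof.
move=> injF h.
have: w \in [seq t.2 | t <- pimage F p].
  by apply: contraNT h => /ocoef_notin ->.
rewrite -map_comp => /mapP[t _ /= wE]; exists t.2 => //.
by rewrite -(ocoef_pimage_inj p t.2 injF) -wE.
Qed.

Lemma pimage_comp F G p : pimage (F \o G) p = pimage F (pimage G p).
Proof. by rewrite /pimage -map_comp. Qed.

Lemma pimage_cat F p q : pimage F (p ++ q) = pimage F p ++ pimage F q.
Proof. exact: map_cat. Qed.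

Lemma pimage_scale F c p : pimage F (pscale c p) = pscale c (pimage F p).
Proof. by rewrite /pimage /pscale -!map_comp. Qed.

Lemma pimage_sub F p q : pimage F (psub p q) = psub (pimage F p) (pimage F q).
Proof. by rewrite pimage_cat pimage_scale. Qed.

(** Linear combinations of the [pimage F s] with [Q F s]. Both constructors work up to [peq], since
    polynomials are lists and not their classes. *)
Inductive span (Q : (word -> word) -> opoly -> Prop) : opoly -> Prop :=
  | Span_zero f : peq f [::] -> span Q f
  | Span_add c F s g f : Q F s -> span Q g ->
      peq f (pscale c (pimage F s) ++ g) -> span Q f.

Section Span.
Variable Q : (word -> word) -> opoly -> Prop.

Lemma span_peq f g : peq f g -> span Q f -> span Q g.
Proof.
move=> fg sf; case: sf fg => [h f0|c F s h k QF sh hE] fg.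
  by apply: Span_zero => w; rewrite -fg f0.
by apply: Span_add QF sh _ => w; rewrite -fg hE.
Qed.

Lemma span_cat f g : span Q f -> span Q g -> span Q (f ++ g).
Proof.
move=> sf sg; elim: sf => [h h0|c F s h k QF _ IH kE].
  by apply: span_peq sg => w; rewrite ocoef_cat h0 ocoefE add0r.
by apply: Span_add QF IH _ => w; rewrite !ocoef_cat kE !ocoefE addrA.
Qed.

Lemma span_scale c f : span Q f -> span Q (pscale c f).
Proof.
elim=> [h h0|d F s h k QF _ IH kE].
  by apply: Span_zero => w; rewrite ocoef_scale h0 ocoefE mulr0.
apply: (Span_add (c := c * d) QF IH) => w; rewrite ocoef_scale kE !ocoefE.
by rewrite mulrDr mulrA.
Qed.

Lemma span_sub f g : span Q f -> span Q g -> span Q (psub f g).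
Proof. by move=> sf sg; apply/span_cat/span_scale. Qed.

Lemma span_gen F s : Q F s -> span Q (pimage F s).
Proof.
move=> QF; apply: (Span_add (c := 1) (g := [::]) QF); first exact: Span_zero.
by move=> w; rewrite !ocoefE mul1r addr0.
Qed.

Lemma span_sum (r : opoly) (H : word -> opoly) :
  (forall t, t \in r -> span Q (H t.2)) ->
  span Q (flatten [seq pscale t.1 (H t.2) | t <- r]).
Proof.
elim: r => [|t r IH] h /=; first exact: Span_zero.
apply: span_cat; first by apply/span_scale/h; rewrite mem_head.
by apply: IH => s sr; apply: h; rewrite inE sr orbT.
Qed.
End Span.

Lemma span_pimage (Q Q' : (word -> word) -> opoly -> Prop) G f :
  (forall F s, Q F s -> Q' (G \o F) s) -> span Q f -> span Q' (pimage G f).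
Proof.
move=> QQ'; elim=> [h h0|c F s h k /QQ' QF _ IH kE].
  by apply: Span_zero => w; rewrite (peq_pimage G h0).
apply: (Span_add (c := c) QF IH) => w.
by rewrite (peq_pimage G kE) pimage_cat pimage_scale -pimage_comp.
Qed.

Lemma span_mono (Q Q' : (word -> word) -> opoly -> Prop) f :
  (forall F s, Q F s -> Q' F s) -> span Q f -> span Q' f.
Proof.
move=> QQ'; elim=> [h h0|c F s h k /QQ' QF _ IH kE]; first exact: Span_zero.
exact: Span_add QF IH kE.
Qed.

(** Links [span] to the explicit lists of [in_Id] and [congr_mod], exchanging functional contexts
    for words with a star. *)
Lemma span_combP (Q : (word -> word) -> opoly -> Prop) f :
  (forall F s, Q F s -> wctx F) ->
  span Q f <-> exists l : seq (K * ctx Om X * opoly),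
    (forall t, t \in l -> is_ctx t.1.2 /\ Q (fun w => substW w t.1.2) t.2) /\
    peq f (comb l).
Proof.
move=> Qctx; split.
  elim=> [h h0|c F s h k QF _ [l [hl hE]] kE]; first by exists [::].
  have [u hu FE] := wctx_is_ctx (Qctx _ _ QF).
  move: (functional_extensionality _ _ FE) => {}FE; subst F.
  exists ((c, u, s) :: l); split=> [t|w]; last first.
    by rewrite kE /= !ocoef_cat hE.
  by rewrite inE => /orP[/eqP -> //|]; apply: hl.
case=> l []; elim: l f => [|[[c u] s] l IH] f hl fE; first exact: Span_zero.
have [hu Qs] := hl _ (mem_head _ _).
apply: (Span_add (c := c) (g := comb l) Qs _ fE).
by apply: IH => // t tl; apply: hl; rewrite inE tl orbT.
Qed.

Lemma ocoef_flatten_scale (r : opoly) (H : word -> opoly) w :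
  ocoef (flatten [seq pscale t.1 (H t.2) | t <- r]) w =
  peval (fun v => ocoef (H v) w) r.
Proof.
elim: r => [|t r IH] /=; first by rewrite ocoef_nil /peval big_nil.
by rewrite ocoef_cat ocoef_scale IH /peval big_cons.
Qed.

Lemma ocoef_drop0 p w : ocoef [seq t <- p | t.1 != 0] w = ocoef p w.
Proof.
rewrite /ocoef big_filter big_mkcond; apply: eq_bigr => t _ /=.
by case: eqP => //= ->; case: ifP.
Qed.

Lemma psupport p : exists2 r : opoly, peq p r &
  forall t, t \in r -> ocoef p t.2 != 0.
Proof.
exists [seq t <- pnorm p | t.1 != 0] => [w|t].
  by rewrite ocoef_drop0 pnorm_peq.
rewrite mem_filter => /andP[t0 tp]; rewrite -pnorm_peq ocoef_uniq //.
by rewrite pnorm_words undup_uniq.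
Qed.

Lemma not_nonzero p : ~ nonzero p -> peq p [::].
Proof.
move=> h w; rewrite ocoef_nil; apply/eqP/negPn/negP => p0.
by apply: h; exists w.
Qed.

(** * Monomial orderings and leading words *)

Section Order.
Variables (lt : word -> word -> Prop) (hlt : monomial_order lt).
Let le v w := v = w \/ lt v w.

(** All words below a least inaccessible word would be accessible, making that word accessible
    too. *)
Lemma lt_wf : well_founded lt.
Proof.
move=> w; apply: NNPP => hw.
have [m [hm mmin]] := mo_wellorder hlt (ex_intro (fun w => ~ Acc lt w) w hw).
apply: hm; constructor=> v vm; apply: NNPP => hv.
have [E|/(mmin _ hv) mv] := classic (m = v).
  by rewrite E in vm; apply: (mo_irrefl hlt) vm.
exact: (mo_irrefl hlt) (mo_trans hlt vm mv).
Qed.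

Let le_lt_trans v w x : le v w -> lt w x -> lt v x.
Proof. by case=> [->//|vw wx]; apply: (mo_trans hlt) wx. Qed.

Let le_total v w : le v w \/ lt w v.
Proof.
have [->|/(mo_total hlt)[]] := classic (v = w); rewrite /le; tauto.
Qed.

Lemma wctx_lt F v w : wctx F -> lt v w -> lt (F v) (F w).
Proof. by case/wctx_is_ctx => u hu FE; rewrite !FE; apply: (mo_compat hlt). Qed.

(** Contexts are strictly monotone for a total order. *)
Lemma wctx_inj F : wctx F -> injective F.
Proof.
move=> hF v w E; apply: NNPP => /(mo_total hlt)[] /(wctx_lt hF);
  rewrite E; exact: (mo_irrefl hlt).
Qed.

Lemma is_lead_unique p v w : is_lead lt p v -> is_lead lt p w -> v = w.
Proof.
move=> [v0 vm] [w0 wm]; have [//|wv] := wm _ v0; have [//|vw] := vm _ w0.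
by case: (mo_irrefl hlt (mo_trans hlt vw wv)).
Qed.

Lemma is_lead_pimage F p w :
  wctx F -> is_lead lt p w -> is_lead lt (pimage F p) (F w).
Proof.
move=> hF [w0 wm]; have injF := wctx_inj hF; split=> [|v].
  by rewrite ocoef_pimage_inj.
case/ocoef_pimage_neq0 => // v' -> /wm[->|]; first by left.
by right; apply: wctx_lt.
Qed.

Lemma is_lead_exists p : nonzero p -> exists w, is_lead lt p w.
Proof.
(* The maximum is found by induction over the list; keeping [w0] in front ensures that a word with
   nonzero coefficient is always available. *)
case=> w0 p0; suff [w [wp wm]] : exists w, ocoef p w != 0 /\ forall v,
    v \in w0 :: [seq t.2 | t <- p] -> ocoef p v != 0 -> le v w.
  exists w; split=> // v v0; apply: wm => //; rewrite inE.
  by apply/orP; right; apply: contraNT v0 => /ocoef_notin ->.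
elim: [seq t.2 | t <- p] => [|v l [w [wp wm]]].
  by exists w0; split=> // v; rewrite inE => /eqP -> _; left.
have [vw|wv] := le_total v w.
  exists w; split=> // x; rewrite !inE orbCA => /orP[/eqP -> //|xl].
  by apply: wm; rewrite inE.
have [v0|v0] := eqVneq (ocoef p v) 0.
  exists w; split=> // x; rewrite !inE orbCA => /orP[/eqP ->|xl].
    by rewrite v0 eqxx.
  by apply: wm; rewrite inE.
exists v; split=> // x; rewrite !inE orbCA => /orP[/eqP ->|xl] x0; first by left.
right; apply: le_lt_trans wv; apply: wm => //; by rewrite inE.
Qed.

(** * Multiples of elements of [S] and bounds on their leading words *)

Section Basis.
Variables (S : opoly -> Prop) (hS : forall s, S s -> omonic lt s).

Lemma is_lead_coef1 s w : S s -> is_lead lt s w -> ocoef s w = 1.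
Proof. by move=> /hS[v [hv v1]] /is_lead_unique/(_ hv) ->. Qed.

(** [D] restricts the leading word of the multiple: the trivial condition gives the ideal, being
    below [w] gives congruence modulo [S] and [w]. *)
Definition gen (D : word -> Prop) F s : Prop :=
  [/\ wctx F, S s & exists ws, is_lead lt s ws /\ D (F ws)].
Definition gen_lt w := gen (fun v => lt v w).
Definition gen_le w := gen (fun v => le v w).

Lemma gen_sub (D D' : word -> Prop) : (forall v, D v -> D' v) ->
  forall F s, gen D F s -> gen D' F s.
Proof. by move=> h F s [hF hs [ws [lws /h]]]; split=> //; exists ws. Qed.

Lemma in_IdP f : in_Id S f <-> span (gen (fun=> True)) f.
Proof.
rewrite span_combP; last by move=> F s [].
split=> -[l [hl fE]]; exists l; split=> // t /hl; last by case=> ? [].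
case=> hu hs; have [ws [lws _]] := hS hs; split=> //; split=> //.
  exact: is_ctx_wctx.
by exists ws.
Qed.

Lemma congr_modP w p q : congr_mod lt S w p q <-> span (gen_lt w) (psub p q).
Proof.
rewrite span_combP; last by move=> F s [].
split=> -[l [hl fE]]; exists l; split=> // t /hl; last by case=> ? [].
by case=> hu hs h; split=> //; split=> //; apply: is_ctx_wctx.
Qed.

Lemma congr_mod0P w p : congr_mod lt S w p (pzero _ _ _) <-> span (gen_lt w) p.
Proof.
rewrite congr_modP; by split; apply: span_peq => v; rewrite !ocoefE subr0.
Qed.

(** A word with nonzero coefficient occurs in some multiple, hence is at most its leading word; [D]
    is closed downwards. *)
Lemma span_gen_coef (D : word -> Prop) f v :
  (forall x y, lt x y -> D y -> D x) ->
  span (gen D) f -> ocoef f v != 0 -> D v.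
Proof.
move=> hD; elim=> [g ->|c F s g k [hF hs [ws [lws DF]]] _ IH ->].
  by rewrite ocoef_nil eqxx.
rewrite ocoef_cat ocoef_scale.
have [->|/(is_lead_pimage hF lws).2 vF _] := eqVneq (ocoef (pimage F s) v) 0.
  by rewrite mulr0 add0r.
by case: vF => [->//|/hD]; apply.
Qed.

(** The bound [w] is the largest of the finitely many leading words of the multiples. *)
Lemma span_gen_bound (D : word -> Prop) f : span (gen D) f ->
  peq f [::] \/ exists w, D w /\ span (gen_le w) f.
Proof.
elim=> [g g0|c F s g k [hF hs [ws [lws DF]]] _ IH kE]; first by left.
right; case: IH => [g0|[w [Dw sg]]].
  exists (F ws); split=> //; apply: Span_add kE; last exact: Span_zero.
  by split=> //; exists ws; split=> //; left.
have [Fw|wF] := le_total (F ws) w.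
  by exists w; split=> //; apply: Span_add kE => //; split=> //; exists ws.
exists (F ws); split=> //; apply: Span_add kE.
  by split=> //; exists ws; split=> //; left.
by apply: span_mono sg; apply: gen_sub => v /le_lt_trans h; right; apply: h.
Qed.

(** * From compositions to leading words of ideal elements *)

Lemma monic_split s x : S s -> is_lead lt s x ->
  exists2 r : opoly, peq s ((1, x) :: r) & forall t, t \in r -> lt t.2 x.
Proof.
move=> hs lx; have [r rE hr] := psupport (psub s [:: (1, x)]).
exists r => [w|t /hr].
  by rewrite ocoef_cons -rE !ocoefE /= addr0 addrC subrK.
rewrite !ocoefE /= addr0; case: (x =P t.2) => [<-|nx].
  by rewrite (is_lead_coef1 hs lx) subrr eqxx.
by rewrite subr0 => /lx.2[E|//]; case: nx.
Qed.

(* Expand both arguments of the bilinear [H(s1, s2)] around the leading words: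
   [H(s1, y) - H(x, s2) = H(s1 - x, s2) - H(s1, s2 - y)]. *)
Lemma disjoint_congr (H : word -> word -> word) s1 s2 x y :
  (forall z, wctx (H z)) -> (forall z, wctx (fun a => H a z)) ->
  S s1 -> S s2 -> is_lead lt s1 x -> is_lead lt s2 y ->
  span (gen_lt (H x y)) (psub (pimage (fun z => H z y) s1) (pimage (H x) s2)).
Proof.
move=> h1 h2 S1 S2 lx ly.
have [r1 E1 hr1] := monic_split S1 lx; have [r2 E2 hr2] := monic_split S2 ly.
pose p1 := flatten [seq pscale t.1 (pimage (H t.2) s2) | t <- r1].
pose p2 := flatten [seq pscale t.1 (pimage (fun z => H z t.2) s1) | t <- r2].
apply: (@span_peq _ (psub p1 p2)) => [v|]; last first.
  apply: span_sub.
    apply: (@span_sum _ r1 (fun a => pimage (H a) s2)) => t tr.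
    apply: span_gen; split=> //; exists y; split=> //.
    exact: (wctx_lt (h2 y) (hr1 _ tr)).
  apply: (@span_sum _ r2 (fun a => pimage (fun z => H z a) s1)) => t tr.
  apply: span_gen; split=> //; exists x; split=> //.
  exact: (wctx_lt (h1 x) (hr2 _ tr)).
rewrite !ocoef_sub (ocoef_flatten_scale r1 (fun a => pimage (H a) s2)).
rewrite (ocoef_flatten_scale r2 (fun a => pimage (fun z => H z a) s1)).
set P1 := peval _ r1; set P2 := peval _ r2.
have Q1 : peval (fun a => ocoef (pimage (H a) s2) v) s1 =
    ocoef (pimage (H x) s2) v + P1.
  by rewrite (peq_peval _ E1) /peval big_cons mul1r.
have Q2 : peval (fun a => ocoef (pimage (fun z => H z a) s1) v) s2 =
    ocoef (pimage (fun z => H z y) s1) v + P2.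
  by rewrite (peq_peval _ E2) /peval big_cons mul1r.
have Q12 : peval (fun a => ocoef (pimage (H a) s2) v) s1 =
    peval (fun a => ocoef (pimage (fun z => H z a) s1) v) s2.
  rewrite /peval.
  under eq_bigr do rewrite ocoef_pimage /peval mulr_sumr.
  under [RHS]eq_bigr do rewrite ocoef_pimage /peval mulr_sumr.
  rewrite exchange_big; apply: eq_bigr => t _; apply: eq_bigr => s _.
  by rewrite mulrCA.
by rewrite -[P1](addKr (ocoef (pimage (H x) s2) v)) -Q1 Q12 Q2; ring.
Qed.

(** Nested and intersecting occurrences yield a composition placed in a context [C]; as [C] is
    strictly monotone, it carries the congruence of the composition along. *)
Lemma overlap_congr F G s1 s2 x y : GSbasis lt S -> S s1 -> S s2 ->
  is_lead lt s1 x -> is_lead lt s2 y -> overlap x y F G ->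
  span (gen_lt (F x)) (psub (pimage F s1) (pimage G s2)).
Proof.
move=> gs S1 S2 lx ly [H h1 h2|C D hC hD xE|C a b hC E hbre].
- exact: disjoint_congr.
- have [u hu DE] := wctx_is_ctx hD.
  rewrite pimage_comp -pimage_sub.
  have /congr_mod0P : congr_mod lt S x (psub s1 (psubst u s2)) (pzero _ _ _).
    by apply: (gs _ _ S1 S2).2 lx ly hu _; rewrite -DE.
  have ->: psubst u s2 = pimage D s2 by apply: eq_map => t; rewrite -DE.
  apply: span_pimage => F0 s [hF0 hs [ws [lws ltw]]].
  split=> //; first exact: wctx_comp.
  by exists ws; split=> //; apply: (wctx_lt hC).
- rewrite (pimage_comp C (fun z => wcat z a)) (pimage_comp C (fun z => wcat b z)).
  rewrite -pimage_sub.
  have /congr_mod0P := (gs _ _ S1 S2).1 _ _ _ _ lx ly E hbre.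
  apply: span_pimage => F0 s [hF0 hs [ws [lws ltw]]].
  split=> //; first exact: wctx_comp.
  by exists ws; split=> //; apply: (wctx_lt hC).
Qed.

Lemma occurrences_congr F G s1 s2 x y : GSbasis lt S -> S s1 -> S s2 ->
  is_lead lt s1 x -> is_lead lt s2 y -> wctx F -> wctx G -> F x = G y ->
  span (gen_lt (F x)) (psub (pimage F s1) (pimage G s2)).
Proof.
move=> gs S1 S2 lx ly hF hG E.
have [h|h] := overlap_total hF hG E; first exact: overlap_congr gs S1 S2 lx ly h.
rewrite E; have := span_scale (-1) (overlap_congr gs S2 S1 ly lx h).
by apply: span_peq => v; rewrite !ocoefE mulN1r opprB.
Qed.

(** Modulo multiples below [w], multiples with leading word exactly [w] are interchangeable, so
    their coefficients add up on a single one. *)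
Lemma span_le_split w f : GSbasis lt S -> span (gen_le w) f ->
  span (gen_lt w) f \/ exists c F s ws,
    [/\ wctx F, S s, is_lead lt s ws, F ws = w &
        span (gen_lt w) (psub f (pscale c (pimage F s)))].
Proof.
move=> gs; elim=> [g g0|c F s g f' [hF hs [ws [lws lF]]] _ IH fE].
  by left; apply: Span_zero.
case: lF => [Fw|Fw]; last first.
  have gF : gen_lt w F s by split=> //; exists ws.
  case: IH => [sg|[d [G [s' [ws' [hG hs' lws' Gw sg]]]]]].
    by left; apply: Span_add gF sg fE.
  right; exists d, G, s', ws'; split=> //.
  by apply: (Span_add (c := c) gF sg) => v; rewrite !ocoefE fE !ocoefE addrA.
right; case: IH => [sg|[d [G [s' [ws' [hG hs' lws' Gw sg]]]]]].
  exists c, F, s, ws; split=> //; apply: span_peq sg => v.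
  by rewrite !ocoefE fE !ocoefE addrC addKr.
exists (c + d), G, s', ws'; split=> //.
(* Trade the new multiple for the one already chosen, at the cost of terms below [w]. *)
have := occurrences_congr gs hs hs' lws lws' hF hG (etrans Fw (esym Gw)).
rewrite Fw => /(span_scale c)/span_cat/(_ sg); apply: span_peq => v.
by rewrite !ocoefE fE !ocoefE; ring.
Qed.

Let lt_le_down w x y : lt x y -> le y w -> le x w.
Proof. by move=> xy [<-|yw]; right=> //; apply: (mo_trans hlt) yw. Qed.

(** Well-founded induction on the bound [w]: if the merged multiple is absent or has coefficient
    zero, the bound drops; otherwise nothing cancels it and [w] leads [f]. *)
Lemma span_le_lead w f : GSbasis lt S -> span (gen_le w) f -> nonzero f ->
  exists wf F s ws,
    [/\ is_lead lt f wf, wctx F, S s, is_lead lt s ws & wf = F ws].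
Proof.
move=> gs; elim/(well_founded_ind lt_wf): w f => w IH f sf nf.
have IH' : span (gen_lt w) f -> exists wf F s ws,
    [/\ is_lead lt f wf, wctx F, S s, is_lead lt s ws & wf = F ws].
  case/span_gen_bound => [f0|[w' [ltw sf']]]; last exact: IH sf' nf.
  by case: nf => v; rewrite f0 ocoef_nil eqxx.
case: (span_le_split gs sf) => [//|[c [F [s [ws [hF hs lws Fw sg]]]]]].
have [c0|c0] := eqVneq c 0.
  by apply: IH'; apply: span_peq sg => v; rewrite !ocoefE c0 mul0r subr0.
exists w, F, s, ws; split=> //; split=> [|v]; last first.
  exact: span_gen_coef (@lt_le_down w) sf.
(* The difference from the merged multiple involves only words below [w], and that multiple has
   coefficient [c] at [w] because [s] is monic. *)
suff -> : ocoef f w = c by [].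
apply/eqP; rewrite -subr_eq0; apply/negPn/negP => h.
apply: (mo_irrefl hlt (w := w)).
apply: (span_gen_coef (D := fun v => lt v w) _ sg).
  by move=> x y; apply: (mo_trans hlt).
rewrite !ocoefE -{2}Fw ocoef_pimage_inj ?(is_lead_coef1 hs lws) ?mulr1 //.
exact: wctx_inj.
Qed.

Lemma GSbasis_condII : GSbasis lt S -> condII lt S.
Proof.
move=> gs f /in_IdP/span_gen_bound[f0 [v]|[w [_ sf]] nf].
  by rewrite f0 ocoef_nil eqxx.
have [wf [F [s [ws [lf hF hs lws E]]]]] := span_le_lead gs sf nf.
have [u hu FE] := wctx_is_ctx hF.
by exists wf, u, s, ws; split; rewrite // -FE.
Qed.

(** * Division by [S], and representations with decreasing leading words *)

Lemma sub_coef_lt f g w :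
  (forall v, ocoef f v != 0 -> le v w) -> (forall v, ocoef g v != 0 -> le v w) ->
  ocoef f w = ocoef g w -> forall v, ocoef (psub f g) v != 0 -> lt v w.
Proof.
move=> hf hg E v; rewrite ocoef_sub.
have [->|nv] := classic (v = w); first by rewrite E subrr eqxx.
have [f0|/hf[//|//]] := eqVneq (ocoef f v) 0.
by rewrite f0 sub0r oppr_eq0 => /hg[].
Qed.

Lemma coef_lt_lead f w : (forall v, ocoef f v != 0 -> lt v w) ->
  peq f [::] \/ exists2 w', lt w' w & is_lead lt f w'.
Proof.
move=> hf; have [/is_lead_exists[w' lw]|/not_nonzero f0] := classic (nonzero f).
  by right; exists w' => //; apply: hf; case: lw.
by left.
Qed.

(** An upper bound replaces [is_lead] because [c] may be zero. *)
Lemma scale_pimage_coef F s ws c : wctx F -> S s -> is_lead lt s ws ->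
  ocoef (pscale c (pimage F s)) (F ws) = c /\
  forall v, ocoef (pscale c (pimage F s)) v != 0 -> le v (F ws).
Proof.
move=> hF hs lws; split=> [|v].
  rewrite ocoef_scale ocoef_pimage_inj ?(is_lead_coef1 hs lws) ?mulr1 //.
  exact: wctx_inj.
rewrite ocoef_scale => h; apply: (is_lead_pimage hF lws).2.
by apply: contraNneq h => ->; rewrite mulr0.
Qed.

(** Subtracting the multiple that has the leading term of [f] leaves an ideal element with a smaller
    leading word. The bound by [w] is carried through the induction so that the new multiple can be
    put in front. *)
Lemma condII_decr w f : condII lt S -> in_Id S f -> is_lead lt f w ->
  exists l : seq (K * ctx Om X * opoly * word),
    [/\ forall t, t \in l ->
          [/\ is_ctx t.1.1.2, S t.1.2, is_lead lt t.1.2 t.2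
            & le (substW t.2 t.1.1.2) w],
        peq f (comb [seq t.1 | t <- l])
      & decr lt [seq substW t.2 t.1.1.2 | t <- l]].
Proof.
move=> II; elim/(well_founded_ind lt_wf): w f => w IH f If lf.
have [wf [u [s [ws [lf' hu hs lws E]]]]] := II _ If (ex_intro _ w lf.1).
have {wf lf' E}wE : w = substW ws u by rewrite -E; apply: is_lead_unique lf'.
have hF := is_ctx_wctx hu; set c := ocoef f w.
have [g1 g2] := scale_pimage_coef c hF hs lws.
set g := pscale c _ in g1 g2.
have Ig : in_Id S (psub f g).
  apply/in_IdP/span_sub; first exact/in_IdP.
  by apply/span_scale/span_gen; split=> //; exists ws.
have fg : peq f (g ++ psub f g).
  by move=> v; rewrite !ocoefE addrC subrK.
have [|h|[w' ww' lw']] := @coef_lt_lead (psub f g) w.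
- apply: sub_coef_lt => [|v|]; first exact: lf.2; last by rewrite {2}wE g1.
  by rewrite wE; apply: g2.
- exists [:: (c, u, s, ws)]; split=> //= [t|v].
    by rewrite inE => /eqP -> /=; split=> //; left.
  by rewrite fg /comb /= cats0 ocoef_cat h ocoef_nil addr0.
have [l [hl lE ld]] := IH _ ww' _ Ig lw'.
exists ((c, u, s, ws) :: l); split.
- move=> t; rewrite inE => /orP[/eqP -> /=|/hl[? ? ? h]]; split=> //.
    by left.
  by right; apply: le_lt_trans ww'.
- by move=> v; rewrite fg ocoef_cat lE -ocoef_cat.
- case: l hl ld {lE} => // t l hl /= ld; split=> //.
  rewrite -wE; case: (hl t (mem_head _ _)) => _ _ _ h.
  exact: le_lt_trans ww'.
Qed.

Lemma condII_condII' : condII lt S -> condII' lt S.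
Proof.
move=> II f If /is_lead_exists[w /(condII_decr II If)[l [hl lE ld]]].
by exists l; split=> // t /hl[].
Qed.

Lemma decr_all a (l : seq word) : decr lt (a :: l) ->
  forall b, b \in l -> lt b a.
Proof.
elim: l a => // c l IH a [ca /IH h] b; rewrite inE => /orP[/eqP -> //|/h bc].
exact: (mo_trans hlt) ca.
Qed.

Lemma decr_tail a (l : seq word) : decr lt (a :: l) -> decr lt l.
Proof. by case: l => // b l []. Qed.

(** Strictly decreasing leading words cannot cancel, so the first multiple with nonzero coefficient
    leads the sum. *)
Lemma decr_comb_lead (l : seq (K * ctx Om X * opoly * word)) :
  (forall t, t \in l -> [/\ is_ctx t.1.1.2, S t.1.2 & is_lead lt t.1.2 t.2]) ->
  decr lt [seq substW t.2 t.1.1.2 | t <- l] ->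
  nonzero (comb [seq t.1 | t <- l]) ->
  exists2 t, t \in l &
    is_lead lt (comb [seq t.1 | t <- l]) (substW t.2 t.1.1.2).
Proof.
have tail (t : K * ctx Om X * opoly * word) l0 :
    (forall s, s \in t :: l0 -> [/\ is_ctx s.1.1.2, S s.1.2 & is_lead lt s.1.2 s.2]) ->
    forall s, s \in l0 -> [/\ is_ctx s.1.1.2, S s.1.2 & is_lead lt s.1.2 s.2].
  by move=> h s sl; apply: h; rewrite inE sl orbT.
elim: l => [|[[[c u] s] ws] l IH] hl ld; first by case=> v; rewrite ocoef_nil eqxx.
have [/= hu hs lws] := hl _ (mem_head _ _).
have [g1 g2] := scale_pimage_coef c (is_ctx_wctx hu) hs lws.
rewrite -[comb _]/(pscale c (pimage (fun w => substW w u) s) ++ comb [seq t.1 | t <- l]).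
set g := pscale c _ in g1 g2 *; set h := comb _ in IH *.
have hlt' v : ocoef h v != 0 -> lt v (substW ws u).
  move=> hv; have [|t tl lt_t] := IH (tail _ _ hl) (decr_tail ld).
    by exists v.
  have tw : lt (substW t.2 t.1.1.2) (substW ws u).
    by apply: (decr_all ld); apply: (map_f (fun t => substW t.2 t.1.1.2)).
  by apply: le_lt_trans tw; apply: lt_t.2.
have [c0|c0 _] := eqVneq c 0.
  have gh v : ocoef (g ++ h) v = ocoef h v.
    by rewrite ocoef_cat ocoef_scale c0 mul0r add0r.
  case=> v; rewrite gh => hv.
  have [|t tl lt_t] := IH (tail _ _ hl) (decr_tail ld); first by exists v.
  exists t; first by rewrite inE tl orbT.
  by split=> [|x]; rewrite gh; [apply: lt_t.1|apply: lt_t.2].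
exists (c, u, s, ws); first exact: mem_head.
split=> [|v] /=; rewrite ocoef_cat.
  rewrite g1; suff -> : ocoef h (substW ws u) = 0 by rewrite addr0.
  by apply/eqP/negPn/negP => /hlt'; apply: (mo_irrefl hlt).
have [->|/g2 //] := eqVneq (ocoef g v) 0.
by rewrite add0r => /hlt' ?; right.
Qed.

(** * Irreducible remainders and the basis property *)

Lemma reduction_le w f : (forall v, ocoef f v != 0 -> le v w) ->
  exists2 g : opoly, forall t, t \in g -> Irr lt S t.2 &
    span (gen_le w) (psub f g).
Proof.
elim/(well_founded_ind lt_wf): w f => w IH f hf.
(* One division step: remove the term at [w], either into the irreducible remainder [g0] or by a
   multiple [h]. *)
suff [g0 [h [Ig0 sh hlow]]] : exists g0 h : opoly,
    [/\ forall t, t \in g0 -> Irr lt S t.2, span (gen_le w) h &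
        forall v, ocoef (psub f (g0 ++ h)) v != 0 -> lt v w].
  have [e|[w' ww' lw']] := coef_lt_lead hlow.
    exists g0 => //; apply: span_peq sh => v; move: (e v).
    by rewrite !ocoefE => /eqP; rewrite opprD addrA subr_eq0 => /eqP.
  have [g Ig sg] := IH _ ww' _ lw'.2.
  exists (g0 ++ g) => [t|]; first by rewrite mem_cat => /orP[/Ig0|/Ig].
  have sg' : span (gen_le w) (psub (psub f (g0 ++ h)) g).
    apply: span_mono sg; apply: gen_sub => v vw; right; exact: le_lt_trans ww'.
  apply: span_peq (span_cat sh sg') => v; rewrite !ocoefE; ring.
(* As [w] is only an upper bound, [c] may be zero. *)
set c := ocoef f w.
have [Iw|nI] := classic (Irr lt S w).
  exists [:: (c, w)], [::]; split.
  - by move=> t; rewrite inE => /eqP ->.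
  - exact: Span_zero.
  apply: sub_coef_lt => // [v|]; rewrite !ocoefE /= !addr0; last by rewrite eqxx.
  by case: (w =P v) => [->|]; [left|rewrite eqxx].
have [u [s [ws [hu hs lws wE]]]] : exists u s ws,
    [/\ is_ctx u, S s, is_lead lt s ws & w = substW ws u].
  apply: NNPP => h; apply: nI => u s ws hu hs lws wE; apply: h.
  by exists u, s, ws.
have [g1 g2] := scale_pimage_coef c (is_ctx_wctx hu) hs lws.
exists [::], (pscale c (pimage (fun w => substW w u) s)); split=> //.
  apply/span_scale/span_gen; split=> //; first exact: is_ctx_wctx.
  by exists ws; split=> //; left.
rewrite -wE in g1 g2.
by apply: sub_coef_lt.
Qed.

(** Division gives spanning. For independence, a nonzero ideal element would contain its own leading
    word, which is reducible. *)
Lemma condII'_Irr_basis : condII' lt S -> Irr_basis lt S.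
Proof.
move=> II'; split=> [f|g ug Ig idg t tg].
  have [/is_lead_exists[w lw]|/not_nonzero f0] := classic (nonzero f).
    have [g Ig sg] := reduction_le lw.2; exists g; split=> //.
    by apply/in_IdP; apply: span_mono sg; apply: gen_sub.
  exists [::]; split=> //; apply/in_IdP/Span_zero => v.
  by rewrite ocoef_sub f0 !ocoefE subr0.
rewrite -(ocoef_uniq ug tg); apply/eqP/negPn/negP => t0.
have [l [hl lE ld]] := II' _ idg (ex_intro _ t.2 t0).
have [|[[[c u] s] ws] tl [h _]] := decr_comb_lead hl ld.
  by exists t.2; rewrite -lE.
have [/= hu hs lws] := hl _ tl.
have : substW ws u \in [seq t.2 | t <- g].
  by apply: contraNT h => /ocoef_notin /= E; rewrite -lE /= E.
case/mapP => t' tg' E; exact: (Ig t' tg' u s ws hu hs lws (esym E)).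
Qed.

(** The remainder of [h] is irreducible and lies in the ideal, so independence makes it zero; the
    division itself is then the required combination below [w]. *)
Lemma Irr_basis_span_lt w h : Irr_basis lt S -> in_Id S h ->
  (forall v, ocoef h v != 0 -> lt v w) -> span (gen_lt w) h.
Proof.
move=> [_ indep] Ih /coef_lt_lead[h0|[w' ww' lw']]; first exact: Span_zero.
have [g Ig sg] := reduction_le lw'.2.
have Idg : in_Id S (pnorm g).
  have s' : span (gen (fun=> True)) (psub h g).
    by apply: span_mono sg; apply: gen_sub.
  apply/in_IdP; apply: span_peq (span_sub (proj1 (in_IdP h) Ih) s') => v.
  by rewrite !ocoef_sub pnorm_peq subKr.
have g0 : peq g [::].
  move=> v; rewrite -pnorm_peq ocoef_nil; apply: big1_seq => t /= tg.
  rewrite (indep (pnorm g)) ?if_same // ?pnorm_words ?undup_uniq //.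
  move=> t' t'g; have: t'.2 \in [seq t.2 | t <- g].
    by rewrite -mem_undup -pnorm_words map_f.
  by case/mapP => t'' /Ig h'' ->.
have {}sg : span (gen_lt w) (psub h g).
  by apply: span_mono sg; apply: gen_sub => v vw; apply: le_lt_trans ww'.
by apply: span_peq sg => v; rewrite ocoef_sub g0 ocoef_nil subr0.
Qed.

(** Both kinds of composition have this form: two multiples share a leading word with coefficient
    one, so their difference lies below it. *)
Lemma composition_congr F G f g x y : Irr_basis lt S -> wctx F -> wctx G ->
  S f -> S g -> is_lead lt f x -> is_lead lt g y -> F x = G y ->
  congr_mod lt S (F x) (psub (pimage F f) (pimage G g)) (pzero _ _ _).
Proof.
move=> hI hF hG hf hg lx ly E; apply/congr_mod0P/Irr_basis_span_lt => //.
  by apply/in_IdP/span_sub; apply: span_gen; split=> //; [exists x|exists y].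
apply: sub_coef_lt.
- exact: (is_lead_pimage hF lx).2.
- by rewrite E; apply: (is_lead_pimage hG ly).2.
rewrite {2}E !ocoef_pimage_inj; try exact: wctx_inj.
by rewrite (is_lead_coef1 hf lx) (is_lead_coef1 hg ly).
Qed.

Lemma Irr_basis_GSbasis : Irr_basis lt S -> GSbasis lt S.
Proof.
move=> hI f g hf hg; split=> [wf wg a b lf lg E _|wf wg u lf lg hu E].
  exact: (composition_congr hI (wctx_wcatr a) (wctx_wcatl b) hf hg lf lg E).
(* In an including composition the context of [f] is the identity. *)
have := composition_congr hI (@wctx_id _ _) (is_ctx_wctx hu) hf hg lf lg E.
rewrite /pimage; under eq_map do rewrite -surjective_pairing.
by rewrite map_id.
Qed.

End Basis.
End Order.
End Poly.

Theorem theorem3p5 (K : comPzRingType) (Om : signature) (X : Type)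
  (har : forall o : Om, (0 < arity o)%N)
  (lt : word Om X -> word Om X -> Prop) (hlt : monomial_order lt)
  (S : opoly K Om X -> Prop) (hS : forall s, S s -> omonic lt s) :
  [<-> GSbasis lt S; condII lt S; condII' lt S; Irr_basis lt S].
Proof.
tfae.
- exact: GSbasis_condII.
- exact: condII_condII'.
- exact: condII'_Irr_basis.
- exact: Irr_basis_GSbasis.
Qed.
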